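(* Let $0<\mu<L$, let $f:\mathbb{R}^d\to\mathbb{R}$ be $L$-smooth and $\mu$-strongly convex, put $g=-\nabla f$ and $\beta=\frac{1-\sqrt{\mu/L}}{1+\sqrt{\mu/L}}$. Let $(x_k)_{k\ge 0}$, $(y_k)_{k\ge 0}$ be sequences in $\mathbb{R}^d$ generated by Nesterov's accelerated gradient method $$y_{k+1}=x_k-\frac1L\nabla f(x_k),\qquad x_{k+1}=y_{k+1}+\beta(y_{k+1}-y_k),\qquad k\ge 0.$$ Then $(x_k)$ is generated by the explicit linear two-step method $(\rho,\sigma)$ with step size $h$, where $$\rho(z)=\beta-(1+\beta)z+z^2,\qquad \sigma(z)=-\beta(1-\beta)+(1-\beta^2)z,\qquad h=\frac{1}{L(1-\beta)};$$ that is, $\rho(E)x_k=h\,\sigma(E)g(x_k)$ for every $k\ge 0$. Moreover $(\rho,\sigma)$ satisfies the consistency conditions $\rho(1)=0$ and $\rho'(1)=\sigma(1)$, and, for this $\rho$ and the given product polynomial $h\sigma(z)=\frac1L\left(-\beta+(1+\beta)z\right)$, this value of $h$ is the only step size for which the consistency conditions hold.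
   Context: $L$-smooth means $\nabla f$ is $L$-Lipschitz for the Euclidean norm. $\mu$-strongly convex means $\mu\|x-y\|^2\le\langle x-y,\nabla f(x)-\nabla f(y)\rangle$ for all $x,y$. The shift operator $E$ acts on sequences by $Ex_k=x_{k+1}$ and $Eg(x_k)=g(x_{k+1})$, so for a polynomial $p(z)=\sum_i p_i z^i$ one has $p(E)x_k=\sum_i p_i x_{k+i}$ and $p(E)g(x_k)=\sum_i p_i g(x_{k+i})$. A linear $s$-step method $(\rho,\sigma)$, with $\rho$ monic of degree $s$ and $\sigma$ with coefficients $\sigma_0,\dots,\sigma_s$, integrates the ODE $\dot x=g(x)$ with step size $h$ by generating sequences with $\rho(E)x_k=h\sigma(E)g(x_k)$ for all $k\ge0$; it is explicit if $\sigma_s=0$. *)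

(* Defs.v *)
From HB Require Import structures.
From mathcomp Require Import all_boot all_order all_algebra.
From mathcomp Require Import all_classical all_reals all_analysis.

Set Implicit Arguments.
Unset Strict Implicit.
Unset Printing Implicit Defensive.

Import Order.TTheory GRing.Theory Num.Theory.
Import numFieldNormedType.Exports.

Local Open Scope ring_scope.

Section Euclidean.
Variables (R : realType) (d : nat).
Implicit Types (u v x : 'rV[R]_d) (f : 'rV[R]_d -> R).

(* The library norm on 'rV[R]_d is the sup norm, so the Euclidean structure is
   defined here.  Differentiability does not depend on the choice of norm. *)
Definition dotp u v : R := \sum_(i < d) u 0 i * v 0 i.

Definition enorm u : R := Num.sqrt (dotp u u).

Definition grad f x : 'rV[R]_d := \row_(i < d) 'D_(delta_mx 0 i) f x.

(* [grad] is a total function, with junk values where [f] has no partial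
   derivatives; hence the explicit differentiability. *)
Definition smooth (L : R) f : Prop :=
  (forall x, differentiable f x) /\
  (forall x y, enorm (grad f x - grad f y) <= L * enorm (x - y)).

Definition strongly_convex (mu : R) f : Prop :=
  forall x y, mu * enorm (x - y) ^+ 2 <= dotp (x - y) (grad f x - grad f y).

Definition nesterov f (L beta : R) (x y : nat -> 'rV[R]_d) : Prop :=
  forall k, y k.+1 = x k - L^-1 *: grad f (x k) /\
            x k.+1 = y k.+1 + beta *: (y k.+1 - y k).

End Euclidean.

Section LinearMultistep.
Variable R : nzRingType.

Definition Eshift (V : Type) (u : nat -> V) : nat -> V := fun k => u k.+1.

(* p(E) u; entry k is \sum_i p_i u_(k + i) *)
Definition poly_shift (V : lmodType R) (p : {poly R}) (u : nat -> V) :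
    nat -> V :=
  fun k => \sum_(i < size p) p`_i *: iter i (@Eshift V) u k.

Definition linear_multistep (s : nat) (rho sigma : {poly R}) : Prop :=
  [/\ rho \is monic, size rho = s.+1 & (size sigma <= s.+1)%N].

Definition explicit_method (s : nat) (sigma : {poly R}) : Prop := sigma`_s = 0.

(* E g(x_k) = g(x_(k+1)), i.e. sigma(E) acts on the sequence g \o x *)
Definition generated_by (V : lmodType R) (rho sigma : {poly R}) (h : R)
    (g : V -> V) (x : nat -> V) : Prop :=
  forall k, poly_shift rho x k = h *: poly_shift sigma (g \o x) k.

Definition consistent (rho sigma : {poly R}) : Prop :=
  rho.[1] = 0 /\ rho^`().[1] = sigma.[1].

End LinearMultistep.

(* Main.v *)
Require Import Defs.
From HB Require Import structures.
From mathcomp Require Import all_boot all_order all_algebra.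
From mathcomp Require Import all_classical all_reals all_analysis.
From mathcomp Require Import ring lra.

Set Implicit Arguments.
Unset Strict Implicit.
Unset Printing Implicit Defensive.

Import Order.TTheory GRing.Theory Num.Theory.
Import numFieldNormedType.Exports.

Local Open Scope ring_scope.

(** Every [y] of positive index is a gradient step from the preceding [x], so eliminating [y] leaves
    a two-step recurrence for [x] alone ([nesterov_recurrence]). Its [x]-coefficients are those of
    [rho], and its gradient coefficients are those of [hsigma]; [poly_shift_widen] turns the
    operators into explicit sums of three and two terms. For the step size, evaluate at 1: [rho] has
    derivative [1 - beta] there and [hsigma] has value [L^-1], so a factorization of [hsigma] as
    [h' *: sigma'] is consistent exactly when [h' * (1 - beta) = L^-1]. *)

Lemma poly_shift_widen (R : nzRingType) (V : lmodType R) (n : nat)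
    (p : {poly R}) (u : nat -> V) (k : nat) : (size p <= n)%N ->
  poly_shift p u k = \sum_(i < n) p`_i *: u (i + k)%N.
Proof.
have itE m : iter m (@Eshift V) u k = u (m + k)%N.
  by elim: m k => //= m IHm k; rewrite /Eshift IHm addnS.
move=> le_pn; rewrite /poly_shift.
under eq_bigr do rewrite itE.
rewrite (big_ord_widen n (fun i => p`_i *: u (i + k)%N) le_pn) big_mkcond /=.
apply: eq_bigr => i _; case: ltnP => // le_pi.
by rewrite nth_default ?scale0r.
Qed.

(** Starting at index [k.+2] involves only [y k.+1] and [y k.+2], both given by gradient steps, so
    the free initial value [y 0] never enters. *)
Lemma nesterov_recurrence (R : realType) (d : nat) (f : 'rV[R]_d -> R)
    (L beta : R) (x y : nat -> 'rV[R]_d) (k : nat) : nesterov f L beta x y ->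
  x k.+2 = (1 + beta) *: (x k.+1 - L^-1 *: grad f (x k.+1))
           - beta *: (x k - L^-1 *: grad f (x k)).
Proof.
move=> xyP; have [yk1 _] := xyP k; have [yk2 ->] := xyP k.+1.
rewrite yk1 yk2 scalerDl scale1r scalerBr addrA; congr (_ + _).
Qed.

Lemma momentum_lt1 (R : realType) (q : R) : 0 < q -> (1 - q) / (1 + q) < 1.
Proof. by move=> q0; rewrite ltr_pdivrMr; lra. Qed.

Theorem mainTheorem1 (R : realType) (d : nat) (mu L : R)
    (f : 'rV[R]_d -> R) (x y : nat -> 'rV[R]_d) :
  let beta : R := (1 - Num.sqrt (mu / L)) / (1 + Num.sqrt (mu / L)) in
  let rho : {poly R} := beta%:P - (1 + beta) *: 'X + 'X^2 in
  let sigma : {poly R} := (- (beta * (1 - beta)))%:P + (1 - beta ^+ 2) *: 'X in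
  let h : R := 1 / (L * (1 - beta)) in
  let hsigma : {poly R} := L^-1 *: ((- beta)%:P + (1 + beta) *: 'X) in
  0 < mu -> mu < L ->
  smooth L f -> strongly_convex mu f ->
  nesterov f L beta x y ->
  [/\ linear_multistep 2 rho sigma /\ explicit_method 2 sigma,
      generated_by rho sigma h (fun z => - grad f z) x,
      consistent rho sigma,
      h *: sigma = hsigma
    & forall (h' : R) (sigma' : {poly R}),
        h' *: sigma' = hsigma -> (consistent rho sigma' <-> h' = h)].
Proof.
move=> beta rho sigma h hsigma mu0 muL _ _ xyP.
have L0 : 0 < L := lt_trans mu0 muL.
have beta1 : beta < 1.
  by apply: momentum_lt1; rewrite sqrtr_gt0 divr_gt0.
(* The rest is algebra in a parameter [beta < 1], which makes [1 - beta] invertible. *)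
clearbody beta.
have b1 : 1 - beta != 0 by rewrite subr_eq0 gt_eqF.
have L_neq0 : L != 0 by rewrite gt_eqF.
have size_rho : size rho = 3.
  rewrite /rho addrC size_polyDl size_polyXn //.
  apply: leq_ltn_trans (size_polyD _ _) _; rewrite gtn_max size_polyN.
  rewrite (leq_ltn_trans (size_polyC_leq1 _)) //=.
  by rewrite (leq_ltn_trans (size_scale_leq _ _)) ?size_polyX.
(* An upper bound suffices, since sums may be padded with zero coefficients. *)
have size_sigma : (size sigma <= 2)%N.
  apply: leq_trans (size_polyD _ _) _; rewrite geq_max.
  rewrite (leq_trans (size_polyC_leq1 _)) //=.
  by rewrite (leq_trans (size_scale_leq _ _)) ?size_polyX.
have rho1 : rho.[1] = 0 by rewrite /rho !hornerE; ring.
have drho1 : rho^`().[1] = 1 - beta.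
  by rewrite /rho derivD derivB derivZ derivC derivX derivXn !hornerE /=; ring.
have hsigma1 : hsigma.[1] = L^-1 by rewrite /hsigma hornerZ hornerD hornerC hornerZ hornerX; ring.
(* The factor [1 - beta] of [1 - beta ^+ 2] and of the constant term cancels against [h]. *)
have hsigmaE : h *: sigma = hsigma.
  apply/polyP => i; rewrite !coefE /h.
  by case: i => [|[|i]] /=; field; rewrite L_neq0 b1.
have consE (h' : R) (sigma' : {poly R}) :
    h' *: sigma' = hsigma -> (consistent rho sigma' <-> h' = h).
  move=> /(congr1 (fun p => p.[1])); rewrite hornerZ hsigma1 => eq1.
  (* The product [h' * sigma'.[1]] equals [L^-1], which is nonzero. *)
  have h'0 : h' != 0.
    by apply: contra_eq_neq eq1 => ->; rewrite mul0r eq_sym invr_eq0.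
  split=> [[_]|h'E]; last split=> //; rewrite drho1.
    by move=> s1; rewrite -s1 in eq1; rewrite /h invfM -eq1 mul1r mulfK.
  apply: (mulfI h'0); rewrite eq1 h'E /h; field.
  by rewrite L_neq0 b1.
split=> //.
- split; last first.
    (* The coefficient at index 2 lies beyond the size of [sigma], hence is the default 0. *)
    by rewrite /explicit_method nth_default.
  split=> //; last exact: leq_trans size_sigma _.
  by rewrite monicE lead_coefE size_rho /rho !coefE /=; apply/eqP; ring.
- move=> k; rewrite (poly_shift_widen _ _ (n := 3)) ?size_rho //.
  rewrite (poly_shift_widen _ _ size_sigma) !big_ord_recr !big_ord0 /=.
  rewrite !add0n !add1n !add2n (nesterov_recurrence k xyP) !coefE /=.
  apply/rowP => i; rewrite !mxE /h; field.
  by rewrite L_neq0 b1.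
(* Consistency of [sigma] itself is the case [h' = h] of the characterization. *)
- exact/(consE h).
Qed.
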